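(* Let $\Omega$ be an unbounded open set in $\mathbb{R}$ with finitely many connected components. If $\Omega$ is spectral, then $\Omega$ has no gaps between its component intervals; that is, $\Omega$ is equal to $\mathbb{R}$ minus the (finite) endpoints of its component intervals.
   Context: For a positive Radon measure $\mu$ on $\mathbb{R}$, $(\Omega,\mu)$ is a spectral pair if for each $f\in L^1(\Omega)\cap L^2(\Omega)$ the function $\hat f(\lambda)=\int_\Omega f(x)e^{-2\pi i\lambda x}dx$ satisfies $\int|\hat f|^2d\mu<\infty$, and the map $f\mapsto\hat f$ from $L^1(\Omega)\cap L^2(\Omega)\subset L^2(\Omega)$ into $L^2(\mu)$ is isometric with dense range. The set $\Omega$ is spectral if there is a positive Radon measure $\mu$ such that $(\Omega,\mu)$ is a spectral pair. *)

(* Defs.v *)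
From HB Require Import structures.
From mathcomp Require Import all_boot all_order all_algebra.
From mathcomp Require Import complex.
From mathcomp Require Import all_classical all_reals all_analysis.

Set Implicit Arguments.
Unset Strict Implicit.
Unset Printing Implicit Defensive.

Import Order.TTheory GRing.Theory Num.Theory.
Import numFieldNormedType.Exports.

Local Open Scope classical_set_scope.
Local Open Scope ring_scope.

Section Spectral.
Variable R : realType.

Notation bmeasure := {measure set (measurableTypeR R) -> \bar R}.
Implicit Types (mu : bmeasure) (D Omega : set R) (f g : R -> R[i]).

Definition leb : bmeasure := @lebesgue_measure R.

(* On the real line both regularity conditions follow from finiteness on
   compact sets. *)
Definition radon mu : Prop :=
  [/\ forall K : set R, compact K -> (mu K < +oo)%E,
      forall A : set (measurableTypeR R), measurable A ->
        mu A = ereal_inf [set mu U | U in [set U : set R | open U /\ A `<=` U]]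
    & forall U : set R, open U ->
        mu U = ereal_sup [set mu K | K in [set K : set R | compact K /\ K `<=` U]]].

Definition cmeasurable D f : Prop :=
  measurable_fun (D : set (measurableTypeR R))
    ((fun x => complex.Re (f x)) : measurableTypeR R -> R) /\
  measurable_fun (D : set (measurableTypeR R))
    ((fun x => complex.Im (f x)) : measurableTypeR R -> R).

Definition cintegral mu D f : R[i] :=
  Complex (\int[mu]_(x in D) complex.Re (f x)) (\int[mu]_(x in D) complex.Im (f x)).

(* [\_ D] extends by zero outside [D]; it gives the norm of L^p(D, mu). *)
Definition Lpnorm mu (p : R) D f : \bar R :=
  Lnorm mu p%:E (EFin \o ((fun x => ComplexField.Normc.normc (f x)) \_ D)).

Definition inLp mu (p : R) D f : Prop :=
  cmeasurable D f /\ (Lpnorm mu p D f < +oo)%E.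

Definition cexpi (t : R) : R[i] := Complex (cos t) (sin t).

Definition fourier Omega f (lambda : R) : R[i] :=
  cintegral leb Omega (fun x => f x * cexpi (- (2 * pi * lambda * x))).

(* The transform is linear in [f], so the norm equality says it is isometric. *)
Definition spectral_pair Omega mu : Prop :=
  [/\ forall f, inLp leb 1 Omega f -> inLp leb 2 Omega f ->
        inLp mu 2 setT (fourier Omega f),
      forall f, inLp leb 1 Omega f -> inLp leb 2 Omega f ->
        Lpnorm mu 2 setT (fourier Omega f) = Lpnorm leb 2 Omega f
    & forall g, inLp mu 2 setT g -> forall e : R, 0 < e ->
        exists f, [/\ inLp leb 1 Omega f, inLp leb 2 Omega f &
          (Lpnorm mu 2 setT (fun l => fourier Omega f l - g l)%R < e%:E)%E]].

Definition spectral Omega : Prop :=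
  exists mu : bmeasure, radon mu /\ spectral_pair Omega mu.

Definition components Omega : set (set R) :=
  [set connected_component Omega x | x in Omega].

(* Infinite ends of unbounded components are excluded. *)
Definition finite_endpoints Omega : set R :=
  [set a : R | exists2 C, components Omega C &
     (has_lbound C /\ a = inf C) \/ (has_ubound C /\ a = sup C)].

End Spectral.

(* Main.v *)
From HB Require Import structures.
Require Import Defs.
From mathcomp Require Import all_boot all_order all_algebra.
From mathcomp Require Import complex lra.
From mathcomp Require Import all_classical all_reals all_analysis.
From mathcomp Require Import measurable_realfun.

(** An unbounded open set [Omega] with finitely many components has an unbounded
    component, hence contains a half-line, hence contains a translate of every
    bounded set ([unbounded_absorbs]).  Translating a function by [t] multiplies
    its Fourier transform by a phase of modulus one, so it changes neither the
    L^2(mu) norm of the transform nor the Lebesgue norm of the function.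
    Therefore, if [(Omega, mu)] is a spectral pair, the transform is isometric
    from Lebesgue L^2 to L^2(mu) on all functions with bounded support, wherever
    that support lies ([spectral_pair_isometry]).

    Suppose that a segment [J] of positive length lies outside [Omega].  The
    transform [G] of the indicator [g] of [J] belongs to L^2(mu), so by density
    of the range it is the limit of transforms of functions [f] living on
    [Omega]; cutting [f] off far away costs little ([Lpnorm_tail]), so [f] may be
    taken with bounded support.  But then the isometry applies to [f - g], and
    as [f] vanishes on [J] the distance from the transform of [f] to [G] is
    at least the norm of [g], a fixed positive number.  This contradiction shows
    that [Omega] is dense ([spectral_dense]).

    What remains is topology: an open dense set with finitely many components
    is the complement of the endpoints of its components
    ([dense_complement_endpoints]). *)

Set Implicit Arguments.
Unset Strict Implicit.
Unset Printing Implicit Defensive.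

Import Order.TTheory GRing.Theory Num.Theory.
Import numFieldNormedType.Exports.
Import ComplexField.Normc.

Local Open Scope classical_set_scope.
Local Open Scope ring_scope.

(** * Complex-valued functions and their L^p norms *)

Section ComplexLp.
Context {R : realType}.
Notation bmeasure := {measure set (measurableTypeR R) -> \bar R}.
Implicit Types (mu : bmeasure) (D E : set (measurableTypeR R)).
Implicit Types (f g : R -> R[i]) (p : R).

Lemma normc_ge0 (z : R[i]) : 0 <= normc z.
Proof. by case: z => a b; rewrite sqrtr_ge0. Qed.

Lemma Re_le_normc (z : R[i]) : `|complex.Re z| <= normc z.
Proof. by case: z => a b /=; rewrite -sqrtr_sqr ler_wsqrtr// lerDl sqr_ge0. Qed.

Lemma Im_le_normc (z : R[i]) : `|complex.Im z| <= normc z.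
Proof. by case: z => a b /=; rewrite -sqrtr_sqr ler_wsqrtr// lerDr sqr_ge0. Qed.

Lemma normc_cexpi (t : R) : normc (cexpi t) = 1.
Proof. by rewrite /= cos2Dsin2 sqrtr1. Qed.

Lemma cexpiD (s t : R) : cexpi (s + t) = cexpi s * cexpi t.
Proof.
rewrite /cexpi cosD sinD; congr Complex.
by rewrite addrC mulrC [X in _ + X]mulrC.
Qed.

Lemma measurable_normc D f : cmeasurable D f ->
  measurable_fun D (fun x => normc (f x)).
Proof.
move=> [mr mi].
have -> : (fun x => normc (f x)) =
    (fun x => Num.sqrt (complex.Re (f x) ^+ 2 + complex.Im (f x) ^+ 2)).
  by apply/funext => x /=; case: (f x).
apply: measurableT_comp.
  by apply: continuous_measurable_fun; exact: sqrt_continuous.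
by apply: measurable_funD; exact: measurable_funX.
Qed.

Lemma measurable_normc_powR D f p : cmeasurable D f ->
  measurable_fun D (fun x => (normc (f x) `^ p)%:E).
Proof.
move=> mf; apply/measurable_EFinP.
apply: (@measurableT_comp _ _ _ _ _ _ (@powR R ^~ p)).
  exact: measurable_powR.
exact: measurable_normc.
Qed.

Lemma cmeasurableS D E f : measurable E -> D `<=` E ->
  cmeasurable E f -> cmeasurable D f.
Proof. by move=> mE DE [fr fi]; split; apply: (measurable_funS mE DE). Qed.

Lemma eq_cmeasurable D f g : (forall x, D x -> f x = g x) ->
  cmeasurable D f -> cmeasurable D g.
Proof.
by move=> fg [fr fi]; split;
  [apply: eq_measurable_fun fr|apply: eq_measurable_fun fi];
  move=> x /[!inE] Dx; rewrite fg.
Qed.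

Lemma cmeasurable_cst D (c : R[i]) : cmeasurable D (cst c).
Proof. by split; exact: measurable_cst. Qed.

Lemma cmeasurableB D f g : cmeasurable D f -> cmeasurable D g ->
  cmeasurable D (fun x => f x - g x).
Proof.
move=> [fr fi] [gr gi]; split.
  rewrite (_ : (fun x => _) =
      (fun x => complex.Re (f x)) \- (fun x => complex.Re (g x))).
    exact: measurable_funB.
  by apply/funext => x /=; case: (f x); case: (g x).
rewrite (_ : (fun x => _) =
    (fun x => complex.Im (f x)) \- (fun x => complex.Im (g x))).
  exact: measurable_funB.
by apply/funext => x /=; case: (f x); case: (g x).
Qed.

Lemma cmeasurableM D f g : cmeasurable D f -> cmeasurable D g ->
  cmeasurable D (fun x => f x * g x).
Proof.
move=> [fr fi] [gr gi]; split.
  rewrite (_ : (fun x => _) =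
      (fun x => complex.Re (f x) * complex.Re (g x)) \-
      (fun x => complex.Im (f x) * complex.Im (g x))).
    by apply: measurable_funB; exact: measurable_funM.
  by apply/funext => x /=; case: (f x); case: (g x).
rewrite (_ : (fun x => _) =
    (fun x => complex.Re (f x) * complex.Im (g x)) \+
    (fun x => complex.Im (f x) * complex.Re (g x))).
  by apply: measurable_funD; exact: measurable_funM.
by apply/funext => x /=; case: (f x); case: (g x).
Qed.

Lemma cmeasurable_cexpi D (a : R) : cmeasurable D (fun x => cexpi (- (a * x))).
Proof.
have lin : continuous (fun x : R => - (a * x)).
  by move=> x; apply: cvgN; apply: cvgMr; exact: cvg_id.
split; apply: measurable_funTS; apply: continuous_measurable_fun => x /=.
  apply: (@continuous_comp _ _ _ (fun x => - (a * x)) cos); [exact: lin|].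
  exact: continuous_cos.
apply: (@continuous_comp _ _ _ (fun x => - (a * x)) sin); [exact: lin|].
exact: continuous_sin.
Qed.

Definition cut (E : set R) f x : R[i] := if x \in E then f x else 0.

Lemma cmeasurable_cut D E f : measurable D -> measurable E ->
  cmeasurable (D `&` E) f -> cmeasurable D (cut E f).
Proof.
move=> mD mE [fr fi]; split.
  rewrite (_ : (fun x => _) = (fun x => complex.Re (f x)) \_ E).
    exact/(measurable_restrict _ mE mD).
  by apply/funext => x; rewrite /cut patchE; case: ifP.
rewrite (_ : (fun x => _) = (fun x => complex.Im (f x)) \_ E).
  exact/(measurable_restrict _ mE mD).
by apply/funext => x; rewrite /cut patchE; case: ifP.
Qed.

Lemma LpnormE mu p D f : p != 0 ->
  Lpnorm mu p D f = ((\int[mu]_(x in D) (normc (f x) `^ p)%:E) `^ p^-1)%E.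
Proof.
move=> p0; rewrite /Lpnorm unlock.
apply: (congr1 (fun z => z `^ p^-1)%E).
rewrite [RHS]integral_mkcond; apply: eq_integral => x _ /=.
rewrite !patchE; case: ifPn => _; rewrite /= ?normr0 ?powR0//.
by rewrite ger0_norm ?normc_ge0.
Qed.

Lemma integral_normc_ge0 mu p D f :
  (0 <= \int[mu]_(x in D) (normc (f x) `^ p)%:E)%E.
Proof. by apply: integral_ge0 => x _; rewrite lee_fin powR_ge0. Qed.

Lemma le_Lpnorm mu p D f g : 0 < p -> measurable D ->
  cmeasurable D f -> cmeasurable D g ->
  (forall x, D x -> normc (f x) <= normc (g x)) ->
  (Lpnorm mu p D f <= Lpnorm mu p D g)%E.
Proof.
move=> p0 mD mf mg fg; have pn0 : p != 0 by rewrite gt_eqF.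
rewrite (LpnormE _ _ _ pn0) (LpnormE _ _ _ pn0).
apply: gt0_ler_poweR; first by rewrite invr_ge0 ltW.
- by rewrite in_itv /= leey andbT integral_normc_ge0.
- by rewrite in_itv /= leey andbT integral_normc_ge0.
apply: ge0_le_integral => //.
- by move=> x _; rewrite lee_fin powR_ge0.
- exact: measurable_normc_powR.
- exact: measurable_normc_powR.
move=> x Dx; rewrite lee_fin.
by rewrite ge0_ler_powR ?nnegrE ?normc_ge0 ?(ltW p0)//; exact: fg.
Qed.

(** The real-valued Minkowski inequality, applied to the moduli extended by
    zero outside [D]. *)
Lemma Lpnorm_subD mu p D f g : 1 <= p -> measurable D ->
  cmeasurable D f -> cmeasurable D g ->
  (Lpnorm mu p D (fun x => f x - g x)%R <=
   Lpnorm mu p D f + Lpnorm mu p D g)%E.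
Proof.
move=> p1 mD mf mg.
have p0 : 0 < p by exact: lt_le_trans p1.
pose F := (fun x => normc (f x)) \_ D; pose G := (fun x => normc (g x)) \_ D.
have mF : measurable_fun setT F.
  by apply/(measurable_restrictT _ mD); exact: measurable_normc.
have mG : measurable_fun setT G.
  by apply/(measurable_restrictT _ mD); exact: measurable_normc.
apply: le_trans (minkowski_EFin mu mF mG p1).
(* The sum of the moduli is seen as a complex function, so that monotonicity
   of [Lpnorm] applies. *)
pose H x := Complex (normc (f x) + normc (g x)) 0.
have -> : Lnorm mu p%:E (EFin \o (F \+ G)) = Lpnorm mu p D H.
  rewrite /Lpnorm; congr Lnorm; apply/funext => x /=.
  rewrite /F /G !patchE; case: ifP => _; last by rewrite addr0.
  by rewrite expr0n addr0 sqrtr_sqr ger0_norm// addr_ge0 ?normc_ge0.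
apply: le_Lpnorm => //; first exact: cmeasurableB.
  by split => //=; apply: measurable_funD; exact: measurable_normc.
move=> x _ /=; rewrite expr0n addr0 sqrtr_sqr.
rewrite ger0_norm ?addr_ge0 ?normc_ge0//.
by rewrite -(normcN (g x)); exact: le_normcD.
Qed.

Lemma eq_Lpnorm mu p D f g : (forall x, D x -> normc (f x) = normc (g x)) ->
  Lpnorm mu p D f = Lpnorm mu p D g.
Proof.
move=> fg; rewrite /Lpnorm; congr Lnorm; apply/funext => x /=.
by rewrite !patchE; case: ifP => //; rewrite inE => Dx; rewrite fg.
Qed.

Lemma Lpnorm_supp mu p D f : (forall x, ~ D x -> f x = 0) ->
  Lpnorm mu p D f = Lpnorm mu p setT f.
Proof.
move=> f0; rewrite /Lpnorm; congr Lnorm; apply/funext => x /=.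
rewrite !patchE in_setT; case: ifPn => //; rewrite notin_setE => /f0 ->.
by rewrite normc0.
Qed.

Lemma inLp_supp mu p D f : measurable D -> (forall x, ~ D x -> f x = 0) ->
  inLp mu p D f -> inLp mu p setT f.
Proof.
move=> mD f0 [mf f1]; split; last by rewrite -(Lpnorm_supp _ _ f0).
have fE x : cut D f x = f x.
  by rewrite /cut; case: ifPn => //; rewrite notin_setE => /f0.
apply: (@eq_cmeasurable _ (cut D f)) => //.
by apply: cmeasurable_cut => //; rewrite setTI.
Qed.

Lemma inLpB mu p D f g : 1 <= p -> measurable D ->
  inLp mu p D f -> inLp mu p D g -> inLp mu p D (fun x => f x - g x).
Proof.
move=> p1 mD [mf f1] [mg g1]; split; first exact: cmeasurableB.
by apply: le_lt_trans (Lpnorm_subD _ p1 mD mf mg) _; rewrite lte_add_pinfty.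
Qed.

Lemma inLp_cut mu p D E f : 0 < p -> measurable D -> measurable E ->
  inLp mu p D f -> inLp mu p D (cut E f).
Proof.
move=> p0 mD mE [mf f1].
have mc : cmeasurable D (cut E f).
  by apply: cmeasurable_cut => //; apply: cmeasurableS mf => //; exact: subIsetl.
split => //; apply: le_lt_trans f1; apply: le_Lpnorm => // x _.
by rewrite /cut; case: ifP => //; rewrite normc0 normc_ge0.
Qed.

Lemma inLp_phase mu p D f (a : R) : inLp mu p D f ->
  inLp mu p D (fun x => f x * cexpi (- (a * x))).
Proof.
move=> [mf f1]; split.
  by apply: cmeasurableM => //; exact: cmeasurable_cexpi.
rewrite (eq_Lpnorm _ _ (g := f))// => x _.
by rewrite normcM normc_cexpi mulr1.
Qed.

(** Dominated convergence: the truncation error tends to zero pointwise and its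
    modulus is at most that of [f]. *)
Lemma Lpnorm_tail mu p D f (e : R) : 0 < p -> 0 < e -> measurable D ->
  inLp mu p D f -> exists n : nat,
    (Lpnorm mu p D (fun x => cut (D `&` `[- n%:R, n%:R]) f x - f x)%R
     < e%:E)%E.
Proof.
move=> p0 e0 mD [mf f1].
pose fn n := cut (D `&` `[- n%:R, n%:R]) f.
have mfn n : cmeasurable D (fn n).
  apply: cmeasurable_cut => //; first exact: measurableI.
  by apply: cmeasurableS mf => //; exact: subIsetl.
have merr n : measurable_fun D (fun x => (normc (fn n x - f x) `^ p)%:E).
  exact: measurable_normc_powR (cmeasurableB (mfn n) mf).
have fi : mu.-integrable D (fun x => (normc (f x) `^ p)%:E).
  apply/integrableP; split; first exact: measurable_normc_powR.
  under eq_integral do rewrite gee0_abs ?lee_fin ?powR_ge0//.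
  move: f1; rewrite LpnormE ?gt_eqF//; apply: lty_poweRy.
  by rewrite invr_eq0 gt_eqF.
have err0 x : D x -> (fun n => (normc (fn n x - f x) `^ p)%:E) @ \oo --> 0%E.
  move=> Dx; apply: cvg_near_cst.
  near=> n.
  have xn : `|x| <= n%:R by near: n; exact: nbhs_infty_ger.
  rewrite /fn /cut ifT; first by rewrite subrr normc0 powR0// gt_eqF.
  by rewrite inE; split => //=; rewrite in_itv /= -ler_norml.
have dom n x : D x ->
    (`|(normc (fn n x - f x) `^ p)%:E| <= (normc (f x) `^ p)%:E)%E.
  move=> Dx; rewrite gee0_abs ?lee_fin ?powR_ge0//.
  apply: ge0_ler_powR; rewrite ?nnegrE ?normc_ge0 ?(ltW p0)//.
  rewrite /fn /cut; case: ifP => _; first by rewrite subrr normc0 normc_ge0.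
  by rewrite sub0r normcN.
have [_ _] := @dominated_convergence _ _ _ mu D mD
  (fun n x => (normc (fn n x - f x) `^ p)%:E) (cst 0%E)
  (fun x => (normc (f x) `^ p)%:E) merr (measurable_cst _)
  (aeW _ err0) fi (aeW _ (fun x n Dx => dom n x Dx)).
rewrite integral0 => /fine_cvgP[_ /cvgrPdist_lt /(_ (e `^ p))].
rewrite powR_gt0// => /(_ isT)[N _ /(_ N (leqnn N))] /=.
rewrite sub0r normrN ger0_norm ?fine_ge0 ?integral_normc_ge0// => IN.
exists N; rewrite LpnormE ?gt_eqF//.
have IN_lty : (\int[mu]_(x in D) (normc (fn N x - f x) `^ p)%:E < +oo)%E.
  case/integrableP : fi => mfi; apply: le_lt_trans.
  apply: ge0_le_integral => //.
  - by move=> x _; rewrite lee_fin powR_ge0.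
  - exact: measurableT_comp.
  move=> x Dx; rewrite [leRHS]gee0_abs ?lee_fin ?powR_ge0//.
  by have := dom N x Dx; rewrite gee0_abs ?lee_fin ?powR_ge0.
rewrite -[X in (X `^ _)%E]fineK ?ge0_fin_numE ?integral_normc_ge0//.
rewrite poweR_EFin lte_fin.
have -> : e = (e `^ p) `^ p^-1 by rewrite -powRrM mulfV ?gt_eqF// powRr1// ltW.
by rewrite gt0_ltr_powR ?invr_gt0// nnegrE ?powR_ge0 ?fine_ge0
  ?integral_normc_ge0.
Unshelve. all: by end_near. Qed.

End ComplexLp.

(** * Complex integrals *)

Section ComplexIntegral.
Context {R : realType}.
Notation bmeasure := {measure set (measurableTypeR R) -> \bar R}.
Implicit Types (mu : bmeasure) (D : set (measurableTypeR R)).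
Implicit Types (f g : R -> R[i]).

Lemma cintegral_supp mu D f : (forall x, ~ D x -> f x = 0) ->
  cintegral mu D f = cintegral mu setT f.
Proof.
move=> f0; rewrite /cintegral; congr Complex; rewrite Rintegral_mkcond;
  apply: eq_Rintegral => x _; rewrite patchE; case: ifPn => //;
  by rewrite notin_setE => /f0 ->.
Qed.

Lemma eq_cintegral mu D f g : (forall x, D x -> f x = g x) ->
  cintegral mu D f = cintegral mu D g.
Proof.
by move=> fg; rewrite /cintegral; congr Complex; apply: eq_Rintegral => x;
  rewrite inE => Dx; rewrite fg.
Qed.

Lemma inLp1_integrable mu D f : measurable D -> inLp mu 1 D f ->
  mu.-integrable D (EFin \o (fun x => complex.Re (f x))) /\
  mu.-integrable D (EFin \o (fun x => complex.Im (f x))).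
Proof.
move=> mD [mf f1].
have nf : mu.-integrable D (EFin \o (fun x => normc (f x))).
  apply/integrableP; split.
    by apply/measurable_EFinP; exact: measurable_normc.
  move: f1; rewrite LpnormE ?oner_neq0// invr1 poweRe1 ?integral_normc_ge0//.
  apply: le_lt_trans; rewrite le_eqVlt; apply/orP; left; apply/eqP.
  apply: eq_integral => x _ /=.
  by rewrite ger0_norm ?normc_ge0// powRr1 ?normc_ge0.
case: mf => mr mi.
split; apply: (le_integrable mD _ _ nf).
- exact/measurable_EFinP.
- by move=> x _ /=; rewrite lee_fin [leRHS]ger0_norm ?normc_ge0// Re_le_normc.
- exact/measurable_EFinP.
- by move=> x _ /=; rewrite lee_fin [leRHS]ger0_norm ?normc_ge0// Im_le_normc.
Qed.

Lemma cintegralB mu D f g : measurable D -> inLp mu 1 D f -> inLp mu 1 D g ->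
  cintegral mu D (fun x => f x - g x) = cintegral mu D f - cintegral mu D g.
Proof.
move=> mD /(inLp1_integrable mD)[fr fi] /(inLp1_integrable mD)[gr gi].
rewrite /cintegral.
have -> : (fun x => complex.Re (f x - g x)) =
    (fun x => complex.Re (f x) - complex.Re (g x)).
  by apply/funext => x; case: (f x); case: (g x).
have -> : (fun x => complex.Im (f x - g x)) =
    (fun x => complex.Im (f x) - complex.Im (g x)).
  by apply/funext => x; case: (f x); case: (g x).
by rewrite !RintegralB.
Qed.

Lemma cintegralZl mu D f (c : R[i]) : measurable D -> inLp mu 1 D f ->
  cintegral mu D (fun x => c * f x) = c * cintegral mu D f.
Proof.
move=> mD /(inLp1_integrable mD)[fr fi].
case: c => a b; rewrite /cintegral.
have -> : (fun x => complex.Re (Complex a b * f x)) =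
    (fun x => a * complex.Re (f x) - b * complex.Im (f x)).
  by apply/funext => x; case: (f x).
have -> : (fun x => complex.Im (Complex a b * f x)) =
    (fun x => a * complex.Im (f x) + b * complex.Re (f x)).
  by apply/funext => x; case: (f x).
have Z (u : R -> R) r : mu.-integrable D (EFin \o u) ->
    mu.-integrable D (EFin \o (fun x => r * u x)).
  move=> ui; have := integrableZl mD r ui.
  by apply: eq_integrable => // x _ /=; rewrite EFinM.
rewrite RintegralB ?RintegralD//; try exact: Z.
by rewrite !RintegralZl.
Qed.

End ComplexIntegral.

(** * Translations and the Fourier transform *)

Section Translation.
Context {R : realType}.
Notation RT := (measurableTypeR R).
Implicit Types (D : set RT) (f g h : R -> R[i]) (t : R).

Lemma measurable_sub_cst t :
  measurable_fun (setT : set RT) ((fun x => x - t) : RT -> RT).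
Proof. exact: measurable_funB. Qed.

(** Lebesgue measure is determined by its values on half-open intervals, whose
    lengths translations preserve. *)
Lemma leb_shift t (A : set RT) : measurable A ->
  pushforward (leb R) ((fun x => x - t) : RT -> RT) A = leb R A.
Proof.
move=> mA; apply/esym.
have mphi := measurable_sub_cst t.
pose phi : {mfun RT >-> RT} :=
  HB.pack ((fun x => x - t) : RT -> RT)
    (isMeasurableFun.Build _ _ _ _ _ mphi).
apply: (@lebesgue_measure_unique R (pushforward (leb R) phi)) => //=.
move=> _ [[a b]] _ <-.
rewrite /pushforward /=.
have -> : (fun x => x - t) @^-1` `]a, b] = `]a + t, b + t]%classic.
  by apply/seteqP; split => x /=; rewrite !in_itv /= ltrBrDr lerBlDr.
rewrite /leb !lebesgue_measure_itv /= !lte_fin ltrD2r -!EFinB.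
by rewrite opprD addrACA subrr addr0.
Qed.

Lemma ge0_integral_shift (f : RT -> \bar R) t :
  measurable_fun setT f -> (forall x, (0 <= f x)%E) ->
  (\int[leb R]_x f (x - t)%R = \int[leb R]_x f x)%E.
Proof.
move=> mf f0; have mphi := measurable_sub_cst t.
rewrite -[LHS](ge0_integral_pushforward mphi (leb R) measurableT mf)//.
by apply: eq_measure_integral => A mA _; exact: leb_shift.
Qed.

Lemma Rintegral_shift (f : R -> R) t :
  (leb R).-integrable setT (EFin \o f) ->
  \int[leb R]_x f (x - t)%R = \int[leb R]_x f x.
Proof.
move=> fi; have mf := measurable_int _ fi.
have mphi := measurable_sub_cst t.
congr fine.
have fi' : (leb R).-integrable setT ((EFin \o f) \o (fun x => x - t)).
  apply/integrableP; split; first exact: measurableT_comp mf mphi.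
  case/integrableP : fi => _; apply: le_lt_trans.
  rewrite (ge0_integral_shift t (f := fun x => `|(f x)%:E|%E))//.
  exact: measurableT_comp mf.
rewrite -[LHS](integral_pushforward mphi mf fi' measurableT).
by apply: eq_measure_integral => A mA _; exact: leb_shift.
Qed.

Lemma cmeasurable_shift f t : cmeasurable setT f ->
  cmeasurable setT (fun x => f (x - t)).
Proof.
move=> [fr fi]; have mphi := measurable_sub_cst t.
by split; [exact: measurableT_comp fr mphi|exact: measurableT_comp fi mphi].
Qed.

Lemma Lpnorm_shift (p : R) f t : p != 0 -> cmeasurable setT f ->
  Lpnorm (leb R) p setT (fun x => f (x - t)) = Lpnorm (leb R) p setT f.
Proof.
move=> p0 mf.
rewrite (LpnormE _ _ _ p0) (LpnormE _ _ _ p0).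
apply: (congr1 (fun z => z `^ p^-1)%E).
apply: (ge0_integral_shift t (f := fun x => (normc (f x) `^ p)%:E)).
  exact: measurable_normc_powR.
by move=> x; rewrite lee_fin powR_ge0.
Qed.

Lemma fourier_supp D f l : (forall x, ~ D x -> f x = 0) ->
  fourier D f l = fourier setT f l.
Proof. by move=> f0; apply: cintegral_supp => x /f0 ->; rewrite mul0r. Qed.

Lemma fourierB D f g l : measurable D ->
  inLp (leb R) 1 D f -> inLp (leb R) 1 D g ->
  fourier D (fun x => f x - g x) l = fourier D f l - fourier D g l.
Proof.
move=> mD f1 g1; rewrite /fourier -cintegralB//; try exact: inLp_phase.
by apply: eq_cintegral => x _; rewrite mulrBl.
Qed.

Lemma fourier_shift h t l : inLp (leb R) 1 setT h ->
  fourier setT (fun x => h (x - t)) l =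
  cexpi (- (2 * pi * l * t)) * fourier setT h l.
Proof.
move=> h1; rewrite /fourier -cintegralZl//; last exact: inLp_phase.
pose k x := cexpi (- (2 * pi * l * t)) * (h x * cexpi (- (2 * pi * l * x))).
have k1 : inLp (leb R) 1 setT k.
  have [mp _] := inLp_phase (2 * pi * l) h1.
  split; first by apply: cmeasurableM => //; exact: cmeasurable_cst.
  rewrite (eq_Lpnorm _ _ (g := h)); first by case: h1.
  by move=> x _; rewrite !normcM !normc_cexpi mulr1 mul1r.
have [kr ki] := inLp1_integrable measurableT k1.
transitivity (cintegral (leb R) setT (fun x => k (x - t))); last first.
  by congr Complex; [exact: Rintegral_shift kr|exact: Rintegral_shift ki].
apply: eq_cintegral => x _.
by rewrite /k mulrCA -cexpiD; congr (_ * cexpi _); lra.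
Qed.

End Translation.

(** * Spectral pairs on sets containing a half-line *)

(** A translation-friendly form of containing arbitrarily long intervals; for
    the sets considered here it says that [Omega] contains a half-line, without
    distinguishing on which side. *)
Definition absorbs_bounded (R : realType) (Omega : set R) :=
  forall r : R, exists t, forall x, `|x| <= r -> Omega (x + t).

Section SpectralPair.
Context {R : realType}.
Notation bmeasure := {measure set (measurableTypeR R) -> \bar R}.
Implicit Types (mu : bmeasure) (D Omega : set (measurableTypeR R)).
Implicit Types (f g h : R -> R[i]).

Lemma inLp_translate (p : R) D h (r t : R) : p != 0 ->
  inLp (leb R) p setT h -> (forall x, r < `|x| -> h x = 0) ->
  (forall x, `|x| <= r -> D (x + t)) ->
  [/\ forall x, ~ D x -> h (x - t) = 0,
      inLp (leb R) p D (fun x => h (x - t)) &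
      Lpnorm (leb R) p D (fun x => h (x - t)) = Lpnorm (leb R) p setT h].
Proof.
move=> p0 [mh h1] hr Dt.
have h0 x : ~ D x -> h (x - t) = 0.
  move=> Dx; apply: hr; rewrite ltNge; apply/negP => /Dt.
  by rewrite subrK.
have E : Lpnorm (leb R) p D (fun x => h (x - t)) = Lpnorm (leb R) p setT h.
  by rewrite Lpnorm_supp// Lpnorm_shift.
split => //; split; last by rewrite E.
by apply: cmeasurableS (cmeasurable_shift t mh).
Qed.

(** The support of [h] may lie anywhere: a translate of [h] is supported in
    [Omega], and its transform differs from that of [h] by a phase. *)
Lemma spectral_pair_isometry Omega mu h (r : R) :
  absorbs_bounded Omega -> spectral_pair Omega mu ->
  inLp (leb R) 1 setT h -> inLp (leb R) 2 setT h ->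
  (forall x, r < `|x| -> h x = 0) ->
  inLp mu 2 setT (fourier setT h) /\
  Lpnorm mu 2 setT (fourier setT h) = Lpnorm (leb R) 2 setT h.
Proof.
move=> /(_ r)[t Ot] [F2 Fiso _] h1 h2 hr.
have [k0 k1 _] := inLp_translate (oner_neq0 _) h1 hr Ot.
have n2 : 2 != 0 :> R by rewrite pnatr_eq0.
have [_ k2 kE] := inLp_translate n2 h2 hr Ot.
pose k x := h (x - t).
have FE l : fourier Omega k l =
    cexpi (- (2 * pi * l * t)) * fourier setT h l.
  by rewrite fourier_supp//; exact: fourier_shift.
have NE : Lpnorm mu 2 setT (fourier setT h) =
    Lpnorm mu 2 setT (fourier Omega k).
  by apply: eq_Lpnorm => l _; rewrite FE normcM normc_cexpi mul1r.
have [mF F1] := F2 _ k1 k2.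
split; last by rewrite NE -kE; exact: Fiso.
split; last by rewrite NE.
(* Measurability of the transform of [h] comes from that of its translate, by
   undoing the phase. *)
apply: (@eq_cmeasurable _ _
  (fun l => fourier Omega k l * cexpi (- (- (2 * pi * t) * l)))).
  move=> l _; rewrite FE mulrC mulrA -cexpiD.
  rewrite [X in cexpi X](_ : _ = 0); last by lra.
  by rewrite /cexpi cos0 sin0 mul1r.
by apply: cmeasurableM => //; exact: cmeasurable_cexpi.
Qed.

Definition cindic (J : set R) : R -> R[i] := cut J (cst 1).

Lemma Lpnorm_cindic (p a b : R) : 0 < p -> a < b ->
  inLp (leb R) p setT (cindic `[a, b]) /\
  Lpnorm (leb R) p setT (cindic `[a, b]) = ((b - a) `^ p^-1)%:E.
Proof.
move=> p0 ab.
have E : Lpnorm (leb R) p setT (cindic `[a, b]) = ((b - a) `^ p^-1)%:E.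
  rewrite LpnormE ?gt_eqF//.
  have -> : (\int[leb R]_x (normc (cindic `[a, b] x) `^ p)%:E = \int[leb R]_x
      (\1_(`[a, b]%classic : set (measurableTypeR R)) x)%:E)%E.
    apply: eq_integral => x _; rewrite /cindic /cut indicE.
    by case: ifP => _; rewrite ?normc1 ?normc0 ?powR1// powR0// gt_eqF.
  rewrite integral_indic// setIT.
  rewrite (_ : leb R _ = lebesgue_measure (`[a, b]%classic : set R))//.
  by rewrite lebesgue_measure_itv /= lte_fin ab -EFinB poweR_EFin.
split => //; split; last by rewrite E ltry.
by apply: cmeasurable_cut => //; exact: cmeasurable_cst.
Qed.

(** The indicator of a segment in a gap has a transform in L^2(mu) that keeps
    a fixed distance from the transforms of functions on [Omega], because the
    isometry turns that distance into a Lebesgue distance. *)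
Lemma spectral_dense Omega mu :
  open (Omega : set R) -> absorbs_bounded Omega -> spectral_pair Omega mu ->
  forall x : R, closure (Omega : set R) x.
Proof.
move=> oO aO sp; apply: contrapT => /existsNP[x0].
rewrite /closure /= => /existsNP[B] /not_implyP[].
move=> /nbhs_ballP[e /= e0 eB] OB.
pose a := x0 - e / 2; pose b := x0 + e / 2.
have ab : a < b by rewrite /a /b; lra.
have OJ x : x \in `[a, b] -> ~ Omega x.
  rewrite in_itv /= => /andP[ax xb] Ox; apply: OB; exists x; split => //.
  apply: eB; rewrite /ball /= ltr_norml.
  by apply/andP; split; move: ax xb; rewrite /a /b; lra.
have mO : measurable Omega by exact: open_measurable.
pose g := cindic `[a, b].
have gO x : Omega x -> g x = 0.
  move=> Ox; rewrite /g /cindic /cut; case: ifP => //.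
  by rewrite inE => /OJ /(_ Ox).
have [g1 _] : inLp (leb R) 1 setT g /\ _ := Lpnorm_cindic ltr01 ab.
have [g2 gE] : inLp (leb R) 2 setT g /\ _ := Lpnorm_cindic (ltr0n _ 2) ab.
pose c := (b - a) `^ 2^-1.
have c0 : 0 < c by rewrite powR_gt0// subr_gt0.
have gr x : `|a| + `|b| < `|x| -> g x = 0.
  move=> rx; rewrite /g /cindic /cut; case: ifP => //.
  rewrite inE /= in_itv /= => /andP[ax xb]; exfalso.
  move: rx; rewrite ltNge => /negP; apply; rewrite ler_norml.
  apply/andP; split.
    by apply: le_trans ax; rewrite lerNl -normrN (le_trans (ler_norm _))// lerDl.
  by rewrite (le_trans xb)// (le_trans (ler_norm _))// lerDr.
have [Fg2 _] := spectral_pair_isometry aO sp g1 g2 gr.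
case: (sp) => F2 Fiso Fdense.
have [f [f1 f2 fg]] := Fdense _ Fg2 (c / 2) (divr_gt0 c0 (ltr0n _ 2)).
have [n fn] := Lpnorm_tail (ltr0n _ 2) (divr_gt0 c0 (ltr0n _ 2)) mO f2.
pose u := cut (Omega `&` `[- n%:R, n%:R]) f.
have mOn : measurable (Omega `&` `[- n%:R, n%:R]%classic).
  exact: measurableI.
have u1 : inLp (leb R) 1 Omega u by exact: inLp_cut.
have u2 : inLp (leb R) 2 Omega u by exact: inLp_cut.
have u0 x : ~ Omega x -> u x = 0.
  by move=> Ox; rewrite /u /cut; case: ifP => //; rewrite inE => -[/Ox].
have U1 := inLp_supp mO u0 u1; have U2 := inLp_supp mO u0 u2.
pose h x := u x - g x.
have le12 : 1 <= 2 :> R by rewrite ler1n.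
have h1 : inLp (leb R) 1 setT h by exact: inLpB.
have h2 : inLp (leb R) 2 setT h by exact: inLpB.
pose r := n%:R + (`|a| + `|b|).
have hr x : r < `|x| -> h x = 0.
  move=> rx; rewrite /h gr ?subr0; last first.
    by apply: le_lt_trans rx; rewrite /r lerDr.
  rewrite /u /cut; case: ifP => //; rewrite inE => -[_] /=.
  rewrite in_itv /= -ler_norml leNgt => /negP[].
  by apply: le_lt_trans rx; rewrite /r lerDl addr_ge0.
have [_ hE] := spectral_pair_isometry aO sp h1 h2 hr.
(* At each point [u] or [g] vanishes, so [h] is at least as large as [g]. *)
have ch : (c%:E <= Lpnorm (leb R) 2 setT h)%E.
  rewrite -gE -/g; apply: le_Lpnorm => //; [by case: g2|by case: h2|].
  move=> x _; have [Ox|Ox] := pselect (Omega x).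
    by rewrite (gO x Ox) normc0 normc_ge0.
  by rewrite /h (u0 x Ox) sub0r normcN.
have FB l : fourier setT h l = fourier Omega (fun x => u x - f x) l -
    (fourier setT g l - fourier Omega f l).
  by rewrite !fourierB// (fourier_supp _ u0) opprB addrA subrK.
have uf1 : inLp (leb R) 1 Omega (fun x => u x - f x) by exact: inLpB.
have uf2 : inLp (leb R) 2 Omega (fun x => u x - f x) by exact: inLpB.
have [muf _] := F2 _ uf1 uf2.
have [mf _] := F2 _ f1 f2.
have [mg _] := Fg2.
move: ch; rewrite -hE; apply/negP; rewrite -ltNge.
rewrite (eq_Lpnorm _ _ (g := fun l => fourier Omega (fun x => u x - f x) l -
  (fourier setT g l - fourier Omega f l))); last by move=> l _; rewrite FB.
apply: le_lt_trans
  (Lpnorm_subD _ le12 measurableT muf (cmeasurableB mg mf)) _.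
rewrite [c]splitr EFinD; apply: lteD; first by rewrite Fiso.
rewrite (eq_Lpnorm _ _
  (g := fun l => fourier Omega f l - fourier setT g l))//.
by move=> l _; rewrite -normcN opprB.
Qed.

End SpectralPair.

(** * Connected components of open subsets of the line *)

Section Components.
Context {R : realType}.
Implicit Types (Omega C : set R).

Lemma component_is_interval Omega C : components Omega C -> is_interval C.
Proof.
by move=> [y _ <-]; apply/connected_intervalP; exact: component_connected.
Qed.

Lemma component_nonempty Omega C : components Omega C -> C !=set0.
Proof. by move=> [y Oy <-]; exists y; exact: connected_component_refl. Qed.

Lemma component_sub Omega C : components Omega C -> C `<=` Omega.
Proof. by move=> [y _ <-]; exact: connected_component_sub. Qed.

Lemma component_unbounded Omega : finite_set (components Omega) ->
  ~ bounded_set Omega ->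
  exists2 C, components Omega C & forall M : R, exists2 x, C x & M < `|x|.
Proof.
move=> fin unb; apply: contrapT => nC; apply: unb.
have bd C : exists M : R, components Omega C -> forall x, C x -> `|x| <= M.
  apply: contrapT => /forallNP CM; apply: nC; exists C.
    by apply: contrapT => nC; apply: (CM 0).
  move=> M; apply: contrapT => nx; apply: (CM M) => _ x Cx.
  by rewrite leNgt; apply/negP => xM; apply: nx; exists x.
have [M MP] := choice bd.
case/finite_seqP : fin => s sE.
(* The sum of the bounds of the components bounds them all at once. *)
exists (\sum_(C <- s) `|M C|); split; first exact: num_real.
move=> N /ltW sN x Ox; apply: le_trans sN.
have CO : components Omega (connected_component Omega x) by exists x.
apply: le_trans (MP _ CO x (connected_component_refl Ox)) _.
have Cs : connected_component Omega x \in s by move: CO; rewrite sE.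
rewrite (le_trans (ler_norm _))// (big_rem _ Cs)/= lerDl.
by apply: sumr_ge0 => *.
Qed.

Lemma unbounded_absorbs Omega : finite_set (components Omega) ->
  ~ bounded_set Omega -> absorbs_bounded Omega.
Proof.
move=> fin unb r.
have [C CO Cunb] := component_unbounded fin unb.
have iC := component_is_interval CO.
have CsO := component_sub CO.
have [c Cc _] := Cunb 0.
have [uC|uC] := pselect (has_ubound C); last first.
  exists (c + r) => x xr; apply: CsO.
  move/has_ubPn : uC => /(_ (x + (c + r)))[z Cz xz].
  apply: (iC c z) => //; apply/andP; split; last exact: ltW.
  by move: xr; rewrite ler_norml => /andP[+ _]; lra.
have lC : ~ has_lbound C.
  move=> [l lC]; case: uC => u uC.
  have [x Cx] := Cunb (`|l| + `|u|); apply/negP; rewrite -leNgt ler_norml.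
  have := lC x Cx; have := uC x Cx.
  have := ler_norm u; have := ler_norm (- l); rewrite normrN.
  have := normr_ge0 l; have := normr_ge0 u.
  by move=> ? ? ? ? ? ?; apply/andP; split; lra.
exists (c - r) => x xr; apply: CsO.
move/has_lbPn : lC => /(_ (x + (c - r)))[z Cz xz].
apply: (iC z c) => //; apply/andP; split; first exact: ltW.
by move: xr; rewrite ler_norml => /andP[_ +]; lra.
Qed.

(** A ball around [x] inside [Omega] is connected and meets [C], so the
    component [C] swallows it. *)
Lemma component_ball Omega C (x : R) : open Omega -> components Omega C ->
  Omega x -> closure C x -> exists2 e : R, 0 < e & ball x e `<=` C.
Proof.
move=> oO [y Oy <-] Ox clC.
have /nbhs_ballP[e /= e0 eO] := oO x Ox.
exists e => //.
have [z [Cz Bz]] := clC _ (nbhsx_ballx x e e0).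
rewrite (same_connected_component Cz).
apply: (connected_component_max Bz eO).
by rewrite ball_itv; exact/connected_intervalP/interval_is_interval.
Qed.

Lemma closure_component Omega (x : R) : finite_set (components Omega) ->
  closure Omega x -> exists2 C, components Omega C & closure C x.
Proof.
move=> fin clO.
have cl : closed (\bigcup_(C in components Omega) closure C).
  by apply: closed_bigcup => // C _; exact: closed_closure.
have sub : Omega `<=` \bigcup_(C in components Omega) closure C.
  move=> y Oy; exists (connected_component Omega y); first by exists y.
  by apply: subset_closure; exact: connected_component_refl.
have := closureS sub clO.
by rewrite -(closure_id _).1.
Qed.

Lemma closure_inf (A : set R) : A !=set0 -> has_lbound A -> closure A (inf A).
Proof.
move=> A0 lA B /nbhs_ballP[e /= e0 eB].
have [z Az ze] := inf_adherent e0 (conj A0 lA).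
exists z; split => //; apply: eB; rewrite /ball /= distrC ger0_norm.
  by rewrite ltrBlDl.
by rewrite subr_ge0; exact: ge_inf.
Qed.

(** An endpoint of [C] in [Omega] would have a neighbourhood inside [C].
    Conversely a point outside [Omega] is adherent to some component by
    finiteness; this component is an interval missing the point, so it lies on
    one side of it and ends there. *)
Lemma dense_complement_endpoints Omega : open Omega ->
  finite_set (components Omega) -> (forall x, closure Omega x) ->
  Omega = ~` finite_endpoints Omega.
Proof.
move=> oO fin clO; apply/seteqP; split => x.
  move=> Ox [C CO [[lC xE]|[uC xE]]]; have C0 := component_nonempty CO.
  - have clC : closure C x by rewrite xE; exact: closure_inf.
    have [e e0 eC] := component_ball oO CO Ox clC.
    have /(ge_inf lC) : C (x - e / 2).
      by apply: eC; rewrite /ball /= opprB addrC subrK gtr0_norm; lra.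
    by rewrite -xE; lra.
  - have clC : closure C x by rewrite xE; exact: closure_sup.
    have [e e0 eC] := component_ball oO CO Ox clC.
    have /(ub_le_sup uC) : C (x + e / 2).
      by apply: eC; rewrite /ball /= opprD addNKr normrN gtr0_norm; lra.
    by rewrite -xE; lra.
move=> nE; apply: contrapT => nO; apply: nE.
have [C CO clC] := closure_component fin (clO x).
have iC := component_is_interval CO.
have nC : ~ C x by move=> /(component_sub CO).
have [y Cy] := component_nonempty CO.
exists C => //.
have [yx|xy|xy] := ltgtP y x; last by rewrite xy in Cy.
- right.
  have ubx : ubound C x.
    move=> z Cz; rewrite leNgt; apply/negP => xz; apply: nC.
    by apply: (iC y z) => //; rewrite !ltW.
  have uC : has_ubound C by exists x.
  split => //; apply/eqP; rewrite eq_le ge_sup ?andbT//; last by exists y.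
  rewrite leNgt; apply/negP => sx.
  have d0 : 0 < x - sup C by rewrite subr_gt0.
  have [z [Cz]] := clC _ (nbhsx_ballx x _ d0).
  rewrite /ball /= ltr_norml => /andP[_].
  by have := ub_le_sup uC Cz; lra.
- left.
  have lbx : lbound C x.
    move=> z Cz; rewrite leNgt; apply/negP => xz; apply: nC.
    by apply: (iC z y) => //; rewrite !ltW.
  have lC : has_lbound C by exists x.
  split => //; apply/eqP; rewrite eq_le lb_le_inf//=; last by exists y.
  rewrite leNgt; apply/negP => sx.
  have d0 : 0 < inf C - x by rewrite subr_gt0.
  have [z [Cz]] := clC _ (nbhsx_ballx x _ d0).
  rewrite /ball /= ltr_norml => /andP[+ _].
  by have := ge_inf lC Cz; lra.
Qed.

End Components.

(** * Unbounded spectral sets have no gaps *)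

Theorem theorem4p8 (R : realType) (Omega : set R) :
  open Omega ->
  ~ bounded_set Omega ->
  finite_set (components Omega) ->
  spectral Omega ->
  Omega = ~` finite_endpoints Omega.
Proof.
move=> oO unb fin [mu [_ sp]].
apply: dense_complement_endpoints => //.
exact: spectral_dense oO (unbounded_absorbs fin unb) sp.
Qed.
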